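(* Let $R$ be a (left) nearfield, $n$ a positive integer, $X=\{x_1,\dots,x_n\}$ a basis of the Beidleman near-vector space $R^n$, and let $T:R^n\to R^n$ be a linear mapping. Let $M$ be the matrix representation of $T$, i.e. the $n\times n$ matrix over $R$ whose $i$-th column is $a_i=x_iT$. Then $T$ is normal if and only if $M$ has at most one non-zero element in each row and in each column.
   Context: A (left) nearfield is a triple $(R,+,\cdot)$ such that $(R,+)$ is a group (necessarily abelian), $(R,\cdot)$ is a semigroup, $a(b+c)=ab+ac$ for all $a,b,c\in R$, and $(R\setminus\{0\},\cdot)$ is a group. $R^n$ is a right module over $R$ with componentwise addition and componentwise right scalar multiplication $(y_1,\dots,y_n)r=(y_1r,\dots,y_nr)$. A submodule (subspace) of $R^n$ is an additive subgroup $N$ with $(m+a)r-mr\in N$ for all $m\in R^n$, $a\in N$, $r\in R$. A basis of $R^n$ is a set $\{x_1,\dots,x_n\}$ such that each $x_iR$ is a submodule and $R^n$ is the direct sum of the $x_iR$, so every $m\in R^n$ is uniquely of the form $m=\sum_i x_ir_i$, and $mr=\sum_i x_ir_ir$; the prototype is the standard basis. The columns of $M$ are the coordinate vectors of the $a_i$ with respect to the basis, as in linear algebra. Maps are written on the right. A mapping $T:R^n\to R^n$ is linear if $(m+m')T=mT+m'T$ and $(mr)T=(mT)r$ for all $m,m'\in R^n$, $r\in R$. A linear mapping $T$ is normal if its image $R^nT$ is a subspace (submodule) of $R^n$.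
   Formalization: For n at least 2 the nearfield R is additionally assumed not to be a division ring (right distributivity fails somewhere), since over a division ring every linear map is normal and the claim is false. *)

(* Defs.v *)
From HB Require Import structures.
From mathcomp Require Import all_boot all_order all_algebra.

Set Implicit Arguments.
Unset Strict Implicit.
Unset Printing Implicit Defensive.

Import GRing.Theory.
Local Open Scope ring_scope.

Definition group_on (T : Type) (D : T -> Prop) (op : T -> T -> T) : Prop :=
  [/\ forall a b, D a -> D b -> D (op a b),
      forall a b c, D a -> D b -> D c -> op a (op b c) = op (op a b) c
    & exists e, [/\ D e,
        forall a, D a -> op e a = a /\ op a e = a
      & forall a, D a -> exists b, [/\ D b, op a b = e & op b a = e]]].

(* A "left" nearfield satisfies a (b + c) = a b + a c, which is called
   right_distributive in MathComp. The law 0 a = 0 is not an axiom. *)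
HB.mixin Record isLeftNearfield R of GRing.Zmodule R := {
  nfmul : R -> R -> R;
  nfmulA : associative nfmul;
  nfmulDr : right_distributive nfmul +%R;
  nf_group : group_on (fun a : R => a <> 0) nfmul
}.

#[short(type="leftNearfieldType")]
HB.structure Definition LeftNearfield :=
  { R of GRing.Zmodule R & isLeftNearfield R }.

Infix "⋅" := nfmul (at level 40, left associativity) : ring_scope.

(* The missing law (a + b) c = a c + b c holds exactly when the nearfield is
   a division ring. *)
Definition is_division_ring (R : leftNearfieldType) : Prop :=
  left_distributive (@nfmul R) +%R.

Section NearVectorSpace.
Variables (R : leftNearfieldType) (n : nat).
Implicit Types (m a : 'rV[R]_n) (r : R) (T : 'rV[R]_n -> 'rV[R]_n).

Definition scaler_right m r : 'rV[R]_n := \row_j (m 0 j ⋅ r).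

Definition is_submodule (N : 'rV[R]_n -> Prop) : Prop :=
  [/\ N 0,
      forall a b, N a -> N b -> N (a - b)
    & forall m a r, N a -> N (scaler_right (m + a) r - scaler_right m r)].

Definition cyclic_set (v : 'rV[R]_n) : 'rV[R]_n -> Prop :=
  fun m => exists r, m = scaler_right v r.

(* The coordinates r are a finfun so that the unique existence refers to a
   type with extensional equality. *)
Definition is_basis (x : 'I_n -> 'rV[R]_n) : Prop :=
  (forall i, is_submodule (cyclic_set (x i))) /\
  (forall m, exists! r : {ffun 'I_n -> R},
      m = \sum_i scaler_right (x i) (r i)).

Definition is_linear T : Prop :=
  (forall m m', T (m + m') = T m + T m') /\
  (forall m r, T (scaler_right m r) = scaler_right (T m) r).

Definition is_normal T : Prop :=
  is_submodule (fun v => exists m, T m = v).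

(* Column i of M lists the coordinates of T (x i) in the basis x. *)
Definition is_matrix_of (x : 'I_n -> 'rV[R]_n) T (M : 'M[R]_n) : Prop :=
  forall i, T (x i) = \sum_j scaler_right (x j) (M j i).

Definition at_most_one_nonzero_per_line (M : 'M[R]_n) : Prop :=
  (forall i j k, M i j != 0 -> M i k != 0 -> j = k) /\
  (forall j i k, M i j != 0 -> M k j != 0 -> i = k).

End NearVectorSpace.

(* Main.v *)
Require Import Defs.
From mathcomp Require Import all_boot all_order all_algebra.

(** Write [m = \sum_j x_j r_j]. Since every sum of the submodules [x_j R] is a
    submodule, right scalar multiplication acts coordinatewise, so in
    coordinates [T] is [r |-> (\sum_i M_ji r_i)_j]. Homogeneity of [T] on a row
    with two non-zero entries gives [(a + b) c = a c + b c], so such a row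
    would make [R] a division ring. Normality on a column with non-zero
    entries in rows [j] and [k] gives the same law: the vector
    [(m + a) r - m r], with [a = T (x_i s)] and [m] a multiple of [x_k], lies in
    the image, and its [j]-th coordinate determines its [k]-th one.
    Conversely, if each line of [M] has at most one non-zero entry, the image
    of [T] is the sum of the [x_j R] over the non-zero rows [j].

    The law [0 a = 0] fails only when [R] has two elements and [a b = b],
    and then every linear map is the identity. *)

Set Implicit Arguments.
Unset Strict Implicit.
Unset Printing Implicit Defensive.

Import GRing.Theory.
Local Open Scope ring_scope.

(** * Arithmetic of left nearfields *)

Section Nearfield.
Variable R : leftNearfieldType.
Implicit Types a b c : R.

Lemma nfmulr0 a : a ⋅ 0 = 0.
Proof. by apply: (addrI (a ⋅ 0)); rewrite -nfmulDr !addr0. Qed.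

Lemma nfmulrN a b : a ⋅ (- b) = - (a ⋅ b).
Proof. by apply: (addrI (a ⋅ b)); rewrite -nfmulDr !subrr nfmulr0. Qed.

Lemma nfmulrB a b c : a ⋅ (b - c) = a ⋅ b - a ⋅ c.
Proof. by rewrite nfmulDr nfmulrN. Qed.

Lemma nfmul_neq0 a b : a != 0 -> b != 0 -> a ⋅ b != 0.
Proof.
have [mul_closed _ _] := nf_group (s := R).
by move=> /eqP a0 /eqP b0; apply/eqP/mul_closed.
Qed.

Lemma nfmulrI a : a != 0 -> injective (nfmul a).
Proof.
move=> a0 b c eq_ab_ac; apply/eqP; rewrite -subr_eq0; apply: contraT => bc0.
by have := nfmul_neq0 a0 bc0; rewrite nfmulrB eq_ab_ac subrr eqxx.
Qed.

Lemma nfmul_surj a c : a != 0 -> exists b, a ⋅ b = c.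
Proof.
move=> /eqP a0; have [_ _ [e [_ unit_e inv_e]]] := nf_group (s := R).
have [->|/eqP c0] := eqVneq c 0; first by exists 0; rewrite nfmulr0.
have [b [_ ab_e _]] := inv_e _ a0; exists (b ⋅ c).
by rewrite nfmulA ab_e; have [] := unit_e _ c0.
Qed.

Lemma nf_neq0_ex : exists a, a != 0.
Proof. by have [_ _ [e [/eqP e0 _ _]]] := nf_group (s := R); exists e. Qed.

(** If [0 ⋅ e] is non-zero, then [c ⋅ (0 ⋅ e) = (c ⋅ 0) ⋅ e = 0 ⋅ e] for every [c]; cancelling
    [0 ⋅ e] on the right makes every non-zero [c] equal to [e]. *)
Lemma nfmul0r_or_proj : (forall a, 0 ⋅ a = 0) \/ (forall a b, a ⋅ b = b).
Proof.
have [_ _ [e [/eqP e0 unit_e inv_e]]] := nf_group (s := R).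
have [z|nz] := eqVneq (0 ⋅ e) 0.
  left=> a.
  have [->|/eqP a0] := eqVneq a 0; first exact: nfmulr0.
  have [a' [/eqP a'0 aa' _]] := inv_e _ a0.
  apply/eqP; apply: contraT => za0.
  by have := nfmul_neq0 za0 a'0; rewrite -nfmulA aa' z eqxx.
right.
have [d [_ db _]] := inv_e _ (elimN eqP nz).
have unit_eq c : c != 0 -> c = e.
  move=> c0.
  have cb : c ⋅ (0 ⋅ e) = 0 ⋅ e by rewrite nfmulA nfmulr0.
  have : c ⋅ ((0 ⋅ e) ⋅ d) = (0 ⋅ e) ⋅ d by rewrite nfmulA cb.
  by rewrite db; have [_ ->] := unit_e _ (elimN eqP c0).
move=> a b; have [->|/unit_eq ->] := eqVneq b 0; first exact: nfmulr0.
have [->|/unit_eq ->] := eqVneq a 0; first exact: unit_eq.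
by have [] := unit_e _ (elimN eqP e0).
Qed.

End Nearfield.

(** * Right scalar multiplication on row vectors *)

Section RightScaling.
Variables (R : leftNearfieldType) (n : nat).
Implicit Types (v : 'rV[R]_n) (r s : R).

Lemma scaler_rightA v r s :
  scaler_right (scaler_right v r) s = scaler_right v (r ⋅ s).
Proof. by apply/rowP=> j; rewrite !mxE nfmulA. Qed.

Lemma scaler_rightD v r s :
  scaler_right v (r + s) = scaler_right v r + scaler_right v s.
Proof. by apply/rowP=> j; rewrite !mxE nfmulDr. Qed.

Lemma scaler_rightB v r s :
  scaler_right v (r - s) = scaler_right v r - scaler_right v s.
Proof. by apply/rowP=> j; rewrite !mxE nfmulrB. Qed.

Lemma scaler_right0 v : scaler_right v 0 = 0.
Proof. by apply/rowP=> j; rewrite !mxE nfmulr0. Qed.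

Lemma scaler_right_sum v (I : finType) (F : I -> R) :
  scaler_right v (\sum_i F i) = \sum_i scaler_right v (F i).
Proof.
exact: (big_morph _ (scaler_rightD v) (scaler_right0 v)).
Qed.

Lemma submodule_ext (N N' : 'rV[R]_n -> Prop) :
  (forall v, N v <-> N' v) -> is_submodule N -> is_submodule N'.
Proof.
move=> NN' [N0 NB NS]; split; first exact/NN'.
  by move=> a b /NN' Na /NN' Nb; apply/NN'/NB.
by move=> m a r /NN' Na; apply/NN'/NS.
Qed.

End RightScaling.

(** * Coordinates with respect to a basis *)

Section Basis.
Variables (R : leftNearfieldType) (n : nat) (x : 'I_n -> 'rV[R]_n).
Hypothesis hx : is_basis x.
Implicit Types (r s u : {ffun 'I_n -> R}) (J : pred 'I_n) (c : R).

Definition comb r : 'rV[R]_n := \sum_i scaler_right (x i) (r i).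

Lemma combD r s : comb (r + s) = comb r + comb s.
Proof.
by rewrite -big_split; apply: eq_bigr => i _; rewrite ffunE scaler_rightD.
Qed.

Lemma combB r s : comb (r - s) = comb r - comb s.
Proof.
rewrite -sumrB; apply: eq_bigr => i _.
by rewrite !ffunE scaler_rightB.
Qed.

Lemma comb_inj : injective comb.
Proof.
move=> r s eq_rs; have [t [_ tu]] := hx.2 (comb r).
by rewrite -(tu r) // -(tu s).
Qed.

Lemma comb_surj v : exists r, v = comb r.
Proof. by have [r [vr _]] := hx.2 v; exists r. Qed.

Definition delta i c : {ffun 'I_n -> R} := [ffun j => if j == i then c else 0].

Lemma comb_delta i c : comb (delta i c) = scaler_right (x i) c.
Proof.
rewrite /comb (bigD1 i) //= big1 ?addr0 ?ffunE ?eqxx // => j /negbTE ji.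
by rewrite ffunE ji scaler_right0.
Qed.

Definition coord_span J : 'rV[R]_n -> Prop :=
  fun v => exists2 r : {ffun 'I_n -> R},
    (forall j, ~~ J j -> r j = 0) & v = comb r.

(** The terms [x_i r_i] of [a] are added to [m] one at a time, so [(m + a) c - m c] telescopes into
    differences that each lie in one submodule [x_i R] with [i] in [J], or vanish because
    [r_i = 0]. *)
Lemma coord_span_submodule J : is_submodule (coord_span J).
Proof.
have span0 : coord_span J 0.
  exists 0 => [j _|]; first by rewrite ffunE.
  by rewrite /comb big1 // => i _; rewrite ffunE scaler_right0.
have spanD v w : coord_span J v -> coord_span J w -> coord_span J (v + w).
  move=> [r r0 ->] [s s0 ->]; exists (r + s); last by rewrite combD.
  by move=> j Jj; rewrite ffunE r0 // s0 // addr0.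
split=> // [v w [r r0 ->] [s s0 ->]|m _ c [r r0 ->]].
  exists (r - s); last by rewrite combB.
  by move=> j Jj; rewrite !ffunE r0 // s0 // subr0.
rewrite /comb; elim: (index_enum _) m => [|i l IHl] m.
  by rewrite big_nil addr0 subrr.
rewrite big_cons addrA; set m' := m + _.
rewrite -(subrKA (scaler_right m' c)); apply: spanD; first exact: IHl.
have [Ji|/r0 ri0] := boolP (J i); last first.
  by rewrite /m' ri0 scaler_right0 addr0 subrr.
have [_ _ cycS] := hx.1 i.
have [|d ->] := cycS m (scaler_right (x i) (r i)) c; first by exists (r i).
exists (delta i d); last by rewrite comb_delta.
by move=> j; rewrite ffunE; case: eqP => // -> /negP.
Qed.

(* The i-th coordinate is isolated by comparing the whole combination with its
   i-th term modulo the submodule spanned by the other terms. *)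
Lemma comb_scale r c : scaler_right (comb r) c = comb [ffun i => r i ⋅ c].
Proof.
have [t ct] := comb_surj (scaler_right (comb r) c).
rewrite ct; congr comb; apply/ffunP=> i; rewrite ffunE.
have [_ _ spanS] := coord_span_submodule (predC1 i).
have [|s s0] := spanS (comb (delta i (r i))) (comb (r - delta i (r i))) c.
  exists (r - delta i (r i)) => // j; rewrite negbK => /eqP ->.
  by rewrite !ffunE eqxx subrr.
rewrite -combD [delta _ _ + _]addrC subrK ct comb_delta scaler_rightA.
rewrite -comb_delta -combB.
by move=> /comb_inj /ffunP/(_ i); rewrite !ffunE eqxx s0 ?negbK //= => /subr0_eq.
Qed.

(** Here [scaler_right v e] is the constant vector [e] whatever [v] is, so uniqueness of coordinates
    leaves room for one basis vector only. *)
Lemma proj_nearfield_index_uniq (i k : 'I_n) :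
  (forall a b : R, a ⋅ b = b) -> i = k.
Proof.
move=> proj; have [e e0] := nf_neq0_ex R.
have scale_const j : scaler_right (x j) e = const_mx e.
  by apply/rowP=> l; rewrite !mxE proj.
have /comb_inj/ffunP/(_ i) : comb (delta i e) = comb (delta k e).
  by rewrite !comb_delta !scale_const.
by rewrite !ffunE eqxx; case: eqP => // _ /eqP; rewrite (negbTE e0).
Qed.

(** * Linear maps in coordinates *)

Section Linear.
Variables (T : 'rV[R]_n -> 'rV[R]_n) (M : 'M[R]_n).
Hypotheses (hT : is_linear T) (hM : is_matrix_of x T M).

Definition coord_map r : {ffun 'I_n -> R} := [ffun j => \sum_i M j i ⋅ r i].

(** Homogeneity and [comb_scale] move [r i] inside the coordinates of [T (x i)]; then the two sums
    are exchanged. *)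
Lemma linear_comb r : T (comb r) = comb (coord_map r).
Proof.
have [TD TZ] := hT.
have T0 : T 0 = 0 by apply: (addrI (T 0)); rewrite -TD !addr0.
rewrite {1}/comb (big_morph T TD T0).
under eq_bigr => i _.
  have -> : T (scaler_right (x i) (r i)) = comb [ffun j => M j i ⋅ r i].
    rewrite TZ hM -[X in scaler_right X _](_ : comb [ffun j => M j i] = _).
      by rewrite comb_scale; congr comb; apply/ffunP=> j; rewrite !ffunE.
    by apply: eq_bigr => j _; rewrite ffunE.
  over.
rewrite /comb exchange_big; apply: eq_bigr => j _ /=.
by rewrite ffunE scaler_right_sum; apply: eq_bigr => i _; rewrite ffunE.
Qed.

Lemma coord_map_scale r c :
  coord_map [ffun i => r i ⋅ c] = [ffun j => coord_map r j ⋅ c].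
Proof.
by apply: comb_inj; rewrite -linear_comb -!comb_scale hT.2 linear_comb.
Qed.

Lemma coord_map_delta i c : coord_map (delta i c) = [ffun j => M j i ⋅ c].
Proof.
apply/ffunP=> j; rewrite !ffunE (bigD1 i) //= big1 => [|k /negbTE ki].
  by rewrite ffunE eqxx addr0.
by rewrite ffunE ki nfmulr0.
Qed.

Lemma image_coordP v : (exists m, T m = v) <-> exists r, v = comb (coord_map r).
Proof.
split=> [[m <-]|[r ->]]; last by exists (comb r); rewrite linear_comb.
by have [r ->] := comb_surj m; exists r; rewrite linear_comb.
Qed.

(** * Normality and the shape of the matrix when [0 a = 0] *)

Hypothesis mul0nf : forall a : R, 0 ⋅ a = 0.

Lemma row_two_nonzero_division_ring i j k :
  M i j != 0 -> M i k != 0 -> j != k -> is_division_ring R.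
Proof.
move=> Mij Mik jk a b c.
(* With these [s] and [t], the vector [x_j s + x_k t] is sent to one whose [i]-th coordinate is
   [a + b]. *)
have [s <-] := nfmul_surj a Mij; have [t <-] := nfmul_surj b Mik.
have sum_jk (f : {ffun 'I_n -> R}) : (forall l, l != j -> l != k -> f l = 0) ->
    \sum_l M i l ⋅ f l = M i j ⋅ f j + M i k ⋅ f k.
  move=> f0; rewrite (bigD1 j) //= (bigD1 k) 1?eq_sym //= big1 ?addr0 //.
  by move=> l /andP[lj lk]; rewrite f0 // nfmulr0.
have /ffunP/(_ i) := coord_map_scale (delta j s + delta k t) c.
rewrite !ffunE !sum_jk.
- by rewrite !ffunE !eqxx (negbTE jk) (eq_sym k) (negbTE jk) addr0 add0r !nfmulA.
- by move=> l /negbTE lj /negbTE lk; rewrite !ffunE lj lk addr0.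
- by move=> l /negbTE lj /negbTE lk; rewrite !ffunE lj lk addr0 mul0nf.
Qed.

Lemma row_single_coord_map i j r :
  (forall k, M j k != 0 -> i = k) -> coord_map r j = M j i ⋅ r i.
Proof.
move=> single; rewrite ffunE (bigD1 i) //= big1 ?addr0 // => k ki.
have [->|/single ik] := eqVneq (M j k) 0; first exact: mul0nf.
by rewrite ik eqxx in ki.
Qed.

(** Let [M k i ⋅ s = b] and let [t] be the coordinates of a preimage of [(m + T (x_i s)) c - m c],
    where [m = x_k a]. By the row hypotheses, coordinates [j] and [k] of the image depend on [t i]
    alone: the [j]-th gives [t i = s ⋅ c], and then the [k]-th reads [(a + b) c - a c = b c]. *)
Lemma column_two_nonzero_division_ring i j k :
  is_normal T -> M j i != 0 -> M k i != 0 -> j != k ->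
  (forall l, M j l != 0 -> i = l) -> (forall l, M k l != 0 -> i = l) ->
  is_division_ring R.
Proof.
move=> [_ _ normT] Mji Mki jk row_j row_k a b c.
have [s <-] := nfmul_surj b Mki.
have img : exists m, T m = comb (coord_map (delta i s)).
  by apply/image_coordP; exists (delta i s).
have /image_coordP[t] := normT (comb (delta k a)) _ c img.
rewrite -combD !comb_scale -combB coord_map_delta => /comb_inj/ffunP eq_t.
have := eq_t k; have := eq_t j.
rewrite (row_single_coord_map _ row_j) (row_single_coord_map _ row_k).
rewrite !ffunE eqxx (negbTE jk) add0r.
rewrite mul0nf subr0 -nfmulA => /(nfmulrI Mji) <-.
by rewrite nfmulA => /(canRL (subrK _)) ->; rewrite addrC.
Qed.

Lemma normal_of_lines : at_most_one_nonzero_per_line M -> is_normal T.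
Proof.
move=> [row1 col1].
apply: submodule_ext (coord_span_submodule (fun j => [exists i, M j i != 0])).
move=> v; split; last first.
  case/image_coordP=> r ->; exists (coord_map r) => // j.
  rewrite negb_exists => /forallP Mj0; rewrite ffunE big1 // => i _.
  by have := Mj0 i; rewrite negbK => /eqP ->; exact: mul0nf.
case=> r r0 ->; apply/image_coordP.
(* A preimage is built column by column: [u i] solves the only equation that column [i] imposes, and
   is 0 for a zero column. *)
have /fin_all_exists[u uP] i :
    exists c, forall j, M j i != 0 -> M j i ⋅ c = r j.
  have [/existsP[j Mji]|none] := boolP [exists j, M j i != 0].
    have [c cE] := nfmul_surj (r j) Mji.
    by exists c => l /(col1 _ _ _ Mji) <-.
  by exists 0 => j Mji; case/existsP: none; exists j.
exists [ffun i => u i]; congr comb; apply/ffunP=> j.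
have [/existsP[i Mji]|Mj0] := boolP [exists i, M j i != 0].
  rewrite (row_single_coord_map _ (fun k => row1 j i k Mji)) ffunE.
  by rewrite (uP _ _ Mji).
rewrite r0 // ffunE big1 // => i _; move: Mj0; rewrite negb_exists.
by move=> /forallP/(_ i); rewrite negbK => /eqP ->; exact: mul0nf.
Qed.

Lemma lines_of_normal :
  ((1 < n)%N -> ~ is_division_ring R) ->
  is_normal T -> at_most_one_nonzero_per_line M.
Proof.
move=> hR normT.
have no_division (j k : 'I_n) : j != k -> ~ is_division_ring R.
  move=> jk; apply: hR; case: n j k jk => [[] //|[|//]] j k.
  by rewrite !ord1.
(* Rows are settled first, since the column argument relies on them. *)
have row1 i j k : M i j != 0 -> M i k != 0 -> j = k.
  move=> Mij Mik; apply/eqP; apply: contraT => jk; case: (no_division _ _ jk).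
  exact: row_two_nonzero_division_ring Mij Mik jk.
split=> // i j k Mji Mki; apply/eqP; apply: contraT => jk.
case: (no_division _ _ jk).
by apply: (column_two_nonzero_division_ring normT Mji Mki jk) => l; exact: row1.
Qed.

End Linear.

(** As [w r] does not depend on [w], [T (x_i r) = T (x_i) r = x_i r]. *)
Lemma proj_nearfield_linear_id (T : 'rV[R]_n -> 'rV[R]_n) v :
  is_linear T -> (forall a b : R, a ⋅ b = b) -> T v = v.
Proof.
move=> [TD TZ] proj.
have T0 : T 0 = 0 by apply: (addrI (T 0)); rewrite -TD !addr0.
have [r ->] := comb_surj v; rewrite /comb (big_morph T TD T0).
by apply: eq_bigr => i _; rewrite TZ; apply/rowP=> j; rewrite !mxE !proj.
Qed.

End Basis.

Theorem theorem3p2 (R : leftNearfieldType) (n : nat) (hn : (0 < n)%N)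
    (hR : (1 < n)%N -> ~ is_division_ring R)
    (x : 'I_n -> 'rV[R]_n) (hx : is_basis x)
    (T : 'rV[R]_n -> 'rV[R]_n) (hT : is_linear T)
    (M : 'M[R]_n) (hM : is_matrix_of x T M) :
  is_normal T <-> at_most_one_nonzero_per_line M.
Proof.
have [mul0nf|proj] := nfmul0r_or_proj R.
  split; first exact: (lines_of_normal hx hT hM mul0nf hR).
  exact: (normal_of_lines hx hT hM mul0nf).
(* In the degenerate case both sides hold: all indices coincide, and the identity has the whole
   space as image. *)
split=> _.
  by split=> ? i k _ _; exact: (proj_nearfield_index_uniq hx).
suff img v : exists m, T m = v by split.
by exists v; exact: (proj_nearfield_linear_id hx).
Qed.
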